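(* Let $n\geq 3$ be an integer and let $\mathcal{F}$ be the class of all sets of cardinality $\leq n$ (viewed as structures in the empty language). Then $\mathcal{F}$ is a Fraïssé class with no Katětov functor.
   Context: Sets are structures in the empty language, so embeddings are one-to-one mappings and automorphisms are bijections. An embedding of structures is a one-to-one mapping that is an isomorphism onto its image. The age of a structure $M$ is the class of all finitely generated structures embeddable into $M$. A Fraïssé class is a class of finitely generated structures, closed under isomorphism, with countably many isomorphism types, that is hereditary (closed under finitely generated substructures) and has the joint embedding and amalgamation properties (for embeddings). For a Fraïssé class $\mathcal{F}$, let ${}^{\mathrm{emb}}\mathcal{F}$ be the category whose objects are structures from $\mathcal{F}$ and whose arrows are all embeddings between them. Let $\sigma\mathcal{F}$ be the class of all countable (possibly finite) structures whose age is contained in $\mathcal{F}$, and ${}^{\mathrm{emb}}\sigma\mathcal{F}$ the category of all embeddings between structures from $\sigma\mathcal{F}$. A Katětov functor on $\mathcal{F}$ is a functor $K\colon {}^{\mathrm{emb}}\mathcal{F}\to{}^{\mathrm{emb}}\sigma\mathcal{F}$ for which there exists a natural transformation $\eta$ from the identity (the inclusion functor of ${}^{\mathrm{emb}}\mathcal{F}$ into ${}^{\mathrm{emb}}\sigma\mathcal{F}$) to $K$ (so each $\eta_X\colon X\to K(X)$ is an embedding) such that for every $X\in\mathcal{F}$ and every one-point extension $e\colon X\to X'$ there exists an embedding $f\colon X'\to K(X)$ satisfying $\eta_X=f\circ e$. Here a one-point extension of $X$ is an embedding $e\colon X\to X'$ with $X'\in\mathcal{F}$ such that $X'$ is generated by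 $e[X]\cup\{x\}$ for some $x\in X'$. *)

(* Defs.v *)
From mathcomp Require Import all_boot.
From mathcomp Require Import boolp classical_sets functions cardinality.

Set Implicit Arguments.
Unset Strict Implicit.
Unset Printing Implicit Defensive.

Local Open Scope classical_set_scope.
Local Open Scope card_scope.

(* Constants are function symbols of arity 0. *)
Record language := Language {
  fsym : Type;
  farity : fsym -> nat;
  rsym : Type;
  rarity : rsym -> nat }.

(* The carrier may be empty. *)
Record structure (L : language) := Structure {
  carrier :> Type;
  finterp : forall s : fsym L, (farity s).-tuple carrier -> carrier;
  rinterp : forall s : rsym L, (rarity s).-tuple carrier -> Prop }.

Arguments finterp {L} M s t : rename.
Arguments rinterp {L} M s t : rename.

Record embedding (L : language) (M N : structure L) := Embedding {
  emb_fun :> M -> N;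
  emb_inj : injective emb_fun;
  emb_finterp : forall s t,
    emb_fun (finterp M s t) = finterp N s (map_tuple emb_fun t);
  emb_rinterp : forall s t,
    rinterp M s t <-> rinterp N s (map_tuple emb_fun t) }.

Section Structures.
Variable L : language.
Implicit Types (M N X Y : structure L) (F : set (structure L)).

Lemma map_tuple_id (T : Type) k (t : k.-tuple T) : map_tuple id t = t.
Proof. by apply: val_inj; rewrite /= map_id. Qed.

Lemma map_tuple_comp (T U V : Type) (g : U -> V) (f : T -> U) k
  (t : k.-tuple T) : map_tuple (g \o f) t = map_tuple g (map_tuple f t).
Proof. by apply: val_inj; rewrite /= -map_comp. Qed.

Definition emb_id M : embedding M M.
Proof.
exists id => [x y //|s t|s t]; by rewrite map_tuple_id.
Defined.

Definition emb_comp M N X (g : embedding N X) (f : embedding M N) :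
  embedding M X.
Proof.
exists (g \o f) => [|s t|s t].
- by apply: inj_comp; apply: emb_inj.
- by rewrite map_tuple_comp /= !emb_finterp.
- by rewrite map_tuple_comp -!emb_rinterp.
Defined.

Definition isomorphic M N : Prop := exists f : embedding M N, bijective f.

Definition fclosed_set M (A : set M) : Prop :=
  forall (s : fsym L) (t : (farity s).-tuple M),
    (forall i, A (tnth t i)) -> A (finterp M s t).

Lemma substructure_subproof M (A : set M) (hA : fclosed_set A) (s : fsym L)
  (t : (farity s).-tuple {x : M | A x}) :
  A (finterp M s (map_tuple sval t)).
Proof. by apply: hA => i; rewrite tnth_map; apply: svalP. Qed.

Definition substructure M (A : set M) (hA : fclosed_set A) : structure L :=
  {| carrier := {x : M | A x};
     finterp := fun s t => exist A _ (substructure_subproof hA t);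
     rinterp := fun s t => rinterp M s (map_tuple sval t) |}.

Definition generates M (S : set M) : Prop :=
  smallest (@fclosed_set M) S = [set: M].

Definition fin_gen M : Prop := exists2 S : set M, finite_set S & generates S.

Definition age M : set (structure L) :=
  [set X : structure L | fin_gen X /\ exists f : embedding X M, True].

Definition joint_embedding F : Prop :=
  forall A B, F A -> F B ->
    exists C, F C /\ exists (f : embedding A C) (g : embedding B C), True.

Definition amalgamation F : Prop :=
  forall A B C (f : embedding A B) (g : embedding A C), F A -> F B -> F C ->
    exists D, F D /\
      exists (f' : embedding B D) (g' : embedding C D), f' \o f =1 g' \o g.

Record fraisse_class F : Prop := FraisseClass {
  fraisse_fin_gen : forall X, F X -> fin_gen X;
  fraisse_iso : forall X Y, isomorphic X Y -> F X -> F Y;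
  fraisse_countable : exists T : nat -> structure L,
    forall X, F X -> exists k, isomorphic X (T k);
  fraisse_hereditary : forall X (A : set X) (hA : fclosed_set A),
    F X -> fin_gen (substructure hA) -> F (substructure hA);
  fraisse_joint_embedding : joint_embedding F;
  fraisse_amalgamation : amalgamation F }.

Definition sigma_class F : set (structure L) :=
  [set M : structure L | countable [set: M] /\ age M `<=` F].

(* Functors between the categories of all embeddings between members of [C]
   and of [D].  The laws are stated pointwise; under functional extensionality
   and proof irrelevance, embeddings that agree pointwise are equal. *)
Record emb_functor (C D : set (structure L)) := EmbFunctor {
  fobj :> {X | C X} -> {X | D X};
  fmap : forall X Y : {X | C X},
    embedding (sval X) (sval Y) -> embedding (sval (fobj X)) (sval (fobj Y));
  fmap_id : forall X : {X | C X}, fmap (emb_id (sval X)) =1 id;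
  fmap_comp : forall (X Y Z : {X | C X})
    (g : embedding (sval Y) (sval Z)) (f : embedding (sval X) (sval Y)),
    fmap (emb_comp g f) =1 fmap g \o fmap f }.

(* [e] may be onto: the new generator is allowed to lie in its image. *)
Definition one_point_extension X X' (e : embedding X X') : Prop :=
  exists x : X', generates (range e `|` [set x]).

Definition is_katetov F (K : emb_functor F (sigma_class F)) : Prop :=
  exists eta : forall X : {X | F X}, embedding (sval X) (sval (K X)),
    (forall (X Y : {X | F X}) (f : embedding (sval X) (sval Y)),
        eta Y \o f =1 fmap K f \o eta X) /\
    (forall (X X' : {X | F X}) (e : embedding (sval X) (sval X')),
        one_point_extension e ->
        exists f : embedding (sval X') (sval (K X)), eta X =1 f \o e).

End Structures.

Definition empty_language : language :=
  @Language void (fun=> 0) void (fun=> 0).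

Definition sets_card_le (n : nat) : set (structure empty_language) :=
  [set X : structure empty_language | [set: X] #<= `I_n].

(* Main.v *)
From HB Require Import structures.
Require Import Defs.
From mathcomp Require Import all_boot.
From mathcomp Require Import boolp classical_sets functions cardinality.
From mathcomp Require Import fingroup perm.

(** Suppose [K] is a Katetov functor, [n = m + 2], and let [swap] be the
transposition of the two points of ['I_n] outside ['I_m]. The set [K 'I_n] has
at most [n] points, so [eta] identifies it with ['I_n], and by naturality
[K swap] is then [swap] itself. The set [K 'I_m] has a point [z] outside the
image of [eta]; the inclusion of ['I_m] in ['I_n] sends [z] to one of the two
swapped points. But [swap] fixes this inclusion, so [K swap] fixes the image of
[z], a contradiction. *)

Set Implicit Arguments.
Unset Strict Implicit.
Unset Printing Implicit Defensive.

Local Open Scope classical_set_scope.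
Local Open Scope card_scope.

(* The type ['I_n] cannot be the carrier of a [structure]: it lives in the
universe of [predArgType], which is strictly above that of carriers. *)
Definition small_ord (n : nat) : Set := {i : nat | i < n}.

Definition ord_of_small n (i : small_ord n) : 'I_n := Ordinal (svalP i).
Definition small_of_ord n (i : 'I_n) : small_ord n :=
  exist _ (val i) (ltn_ord i).

Lemma small_ord_inj n : injective (fun i : small_ord n => sval i).
Proof. by move=> [i i_lt] [j j_lt] /= eij; exact: eq_exist. Qed.

Lemma ord_of_smallK n : cancel (@ord_of_small n) (@small_of_ord n).
Proof. by move=> i; exact: small_ord_inj. Qed.

Lemma small_of_ordK n : cancel (@small_of_ord n) (@ord_of_small n).
Proof. by move=> i; exact: val_inj. Qed.

(** The finite type structure is carried over from ['I_n], so that permutations, transpositions and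
    counting apply to [small_ord n]. *)
HB.instance Definition _ n :=
  Finite.copy (small_ord n) (can_type (@ord_of_smallK n)).

Lemma card_small_ord n : #|{: small_ord n}| = n.
Proof.
rewrite -[RHS]card_ord; apply: (@bij_eq_card _ _ (@ord_of_small n)).
exact: Bijective (@ord_of_smallK n) (@small_of_ordK n).
Qed.

Definition bare_set (T : Type) : structure empty_language :=
  @Structure empty_language T (fun s => match s with end)
    (fun s => match s with end).

Definition inj_embedding (X Y : structure empty_language) (f : X -> Y)
    (f_inj : injective f) : embedding X Y :=
  @Embedding empty_language X Y f f_inj (fun s => match s with end)
    (fun s => match s with end).

(** Needed because [fmap] takes bundled embeddings: a pointwise identity between arrows must become
    an equality before the functor is applied to it. *)
Lemma eq_embedding (L : language) (M N : structure L) (f g : embedding M N) :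
  f =1 g -> f = g.
Proof.
case: f g => [f fI fF fR] [g gI gF gR] /= /funext efg.
by case: g / efg in gI gF gR *; congr Embedding; exact: Prop_irrelevance.
Qed.

(** With no function symbols every subset is closed, so a set generates only itself. *)
Lemma generates_bare (X : structure empty_language) (S : set X) :
  generates S <-> S = [set: X].
Proof. by rewrite /generates smallest_id // => -[]. Qed.

Lemma card_eq_ordP (T : Type) n :
  [set: T] #= `I_n -> exists f : 'I_n -> T, bijective f.
Proof.
rewrite (card_eqr card_II) => /card_esym/card_bijP[f [g fK gK]].
exists (val \o f \o to_setT); exists (val \o g \o to_setT) => x /=.
  by rewrite (_ : to_setT _ = f (to_setT x)) ?fK //; exact: val_inj.
by rewrite (_ : to_setT _ = g (to_setT x)) ?gK //; exact: val_inj.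
Qed.

Lemma card_le_ordP (T : Type) n :
  ([set: T] #<= `I_n) <-> exists f : T -> 'I_n, injective f.
Proof.
rewrite (card_le_eqr card_II).
split=> [/card_leP[f]|[f f_inj]].
  exists (val \o f \o to_setT) => x y /val_inj fxy.
  by have /(congr1 val) := @injT _ _ f _ _ fxy.
have [g] : $|{injfun [set: T] >-> [set: 'I_n]}|.
  by apply/injfunPex; exists f => // x y _ _ /f_inj.
exact: inj_card_le g.
Qed.

Lemma extend_to_perm (T : finType) k (u v : small_ord k -> T) :
  injective u -> injective v -> exists p : {perm T}, p \o u =1 v.
Proof.
have ext (s t : seq T) : uniq s -> uniq t -> size s = size t ->
    exists p : {perm T}, map p s = t.
  elim: s t => [|x s IHs] [|y t] //=; first by exists 1%g.
  move=> /andP[xs us] /andP[yt ut] [/(IHs _ us ut)[p pst]].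
  (* [p] already matches the tails; following it by the transposition of [p x] and [y] corrects the
     head. The tail is undisturbed, since its image contains neither [p x] nor [y] by uniqueness. *)
  exists (p * tperm (p x) y)%g.
  rewrite permM tpermL -[in RHS]pst; congr (_ :: _).
  apply/eq_in_map => z zs; rewrite permM tpermD //.
    by rewrite (inj_eq perm_inj); apply: contraNneq xs => ->.
  by apply: contraNneq yt => ->; rewrite -pst map_f.
move=> u_inj v_inj.
have [||| p] := ext (codom u) (codom v).
- exact/injectiveP.
- exact/injectiveP.
- by rewrite !size_codom.
rewrite !codomE -map_comp => /eq_in_map puv.
by exists p => i; apply: puv; rewrite mem_enum.
Qed.

Definition widen_small_ord k l (kl : k <= l) (i : small_ord k) : small_ord l :=
  exist _ (sval i) (leq_trans (svalP i) kl).

Lemma widen_small_ord_inj k l (kl : k <= l) : injective (widen_small_ord kl).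
Proof. by move=> i j /(congr1 sval) /= /small_ord_inj. Qed.

Section SetsOfBoundedSize.
Variable n : nat.
Implicit Types X Y : structure empty_language.

Lemma sets_card_leP X :
  sets_card_le n X <-> exists f : X -> small_ord n, injective f.
Proof.
rewrite /sets_card_le /= card_le_ordP; split=> -[f f_inj].
  exists (@small_of_ord n \o f).
  exact: inj_comp (can_inj (@small_of_ordK n)) f_inj.
exists (@ord_of_small n \o f).
exact: inj_comp (can_inj (@ord_of_smallK n)) f_inj.
Qed.

Lemma sets_card_le_ord k : k <= n -> sets_card_le n (bare_set (small_ord k)).
Proof.
move=> kn; apply/sets_card_leP; exists (widen_small_ord kn).
exact: widen_small_ord_inj.
Qed.

Lemma bijective_from_ord X :
  sets_card_le n X -> exists k (f : small_ord k -> X), bijective f.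
Proof.
move=> Xn; have /finite_setP[k /card_eq_ordP[f f_bij]] : finite_set [set: X].
  by apply/finite_set_leP; exists n.
exists k, (f \o @ord_of_small k); apply: bij_comp => //.
exact: Bijective (@ord_of_smallK k) (@small_of_ordK k).
Qed.

(** The amalgam is always the full [n]-point set: embed [B] and [C] in it arbitrarily; the two
    resulting copies of [A] differ by a permutation of the [n] points, which is then composed with
    the embedding of [C]. *)
Lemma sets_card_le_amalgamation : amalgamation (sets_card_le n).
Proof.
move=> A B C f g An Bn Cn; exists (bare_set (small_ord n)).
split; first exact: sets_card_le_ord.
have [k [a [a' aK a'K]]] := bijective_from_ord An.
have [b b_inj] := (sets_card_leP B).1 Bn.
have [c c_inj] := (sets_card_leP C).1 Cn.
have [||p pE] := @extend_to_perm (small_ord n) k (c \o g \o a) (b \o f \o a).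
- exact: inj_comp (inj_comp c_inj (@emb_inj _ _ _ g)) (can_inj aK).
- exact: inj_comp (inj_comp b_inj (@emb_inj _ _ _ f)) (can_inj aK).
exists (@inj_embedding B (bare_set (small_ord n)) b b_inj).
exists (@inj_embedding C (bare_set (small_ord n)) (p \o c)
  (inj_comp perm_inj c_inj)).
by move=> x /=; rewrite -(a'K x); exact/esym/pE.
Qed.

Lemma sets_card_le_fraisse : fraisse_class (sets_card_le n).
Proof.
split.
- move=> X Xn; exists [set: X]; last exact/generates_bare.
  by apply/finite_set_leP; exists n.
- move=> X Y [f [g fK gK]] /sets_card_leP[h h_inj].
  by apply/sets_card_leP; exists (h \o g); exact: inj_comp h_inj (can_inj gK).
- exists (fun k => bare_set (small_ord k)).
  move=> X /bijective_from_ord[k [f [g fK gK]]].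
  exists k; exists (@inj_embedding X (bare_set (small_ord k)) g (can_inj gK)).
  by exists f.
- move=> X A hA /sets_card_leP[h h_inj] _.
  apply/sets_card_leP; exists (h \o sval) => -[x Ax] [y Ay] /= /h_inj exy.
  by apply: eq_exist.
- move=> A B /sets_card_leP[a a_inj] /sets_card_leP[b b_inj].
  exists (bare_set (small_ord n)); split; first exact: sets_card_le_ord.
  exists (@inj_embedding A (bare_set (small_ord n)) a a_inj).
  by exists (@inj_embedding B (bare_set (small_ord n)) b b_inj).
- exact: sets_card_le_amalgamation.
Qed.

(** A point [y] missed by [f] would, together with the image of [f], give a copy of the [n + 1]
    points of [option (small_ord n)] in [M], against the bound on the age. *)
Lemma embedding_ord_onto (M : structure empty_language)
    (f : embedding (bare_set (small_ord n)) M) :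
  sigma_class (sets_card_le n) M -> forall y : M, exists i, f i = y.
Proof.
move=> [_ ageM] y; apply: contrapT => fy.
pose g (o : bare_set (option (small_ord n))) := if o is Some i then f i else y.
have g_inj : injective g.
  move=> [i|] [j|] //= => [/emb_inj->//|fiy|/esym fjy].
    by case: fy; exists i.
  by case: fy; exists j.
have /ageM/sets_card_leP[h /leq_card] : age M (bare_set (option (small_ord n))).
  split; last by exists (inj_embedding g_inj).
  exists setT; last exact/generates_bare.
  exact: (@finite_finset (option (small_ord n))).
by rewrite card_option card_small_ord ltnn.
Qed.

End SetsOfBoundedSize.

Lemma no_katetov_functor m
    (K : emb_functor (sets_card_le m.+2) (sigma_class (sets_card_le m.+2))) :
  ~ is_katetov K.
Proof.
move=> [eta [eta_nat eta_ext]].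
pose ord_set k (kn : k <= m.+2) : {X | sets_card_le m.+2 X} :=
  exist _ (bare_set (small_ord k)) (sets_card_le_ord kn).
pose widen k l (kl : k <= l) :=
  @inj_embedding (bare_set (small_ord k)) (bare_set (small_ord l))
    (widen_small_ord kl) (@widen_small_ord_inj k l kl).
pose X := ord_set m (leqW (leqnSn m)); pose X' := ord_set m.+1 (leqnSn m.+1).
pose Y := ord_set m.+2 (leqnn m.+2).
pose f : embedding (sval X) (sval Y) := widen _ _ (leqW (leqnSn m)).
pose a : small_ord m.+2 := exist _ m (leqnSn m.+1).
pose b : small_ord m.+2 := exist _ m.+1 (ltnSn m.+1).
pose swap : embedding (sval Y) (sval Y) :=
  @inj_embedding (bare_set (small_ord m.+2)) (bare_set (small_ord m.+2))
    (tperm a b) perm_inj.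
(* The values of [f] lie below [m], whereas [swap] only moves [m] and [m.+1]. *)
have swapf : emb_comp swap f = f.
  apply: eq_embedding => -[i im] /=.
  apply: tpermD; apply/eqP => /(congr1 sval) /= mi; move: im.
    by rewrite -mi ltnn.
  by rewrite -mi ltnNge leqnSn.
pose top : small_ord m.+1 := exist _ m (ltnSn m).
have [g gE] : exists g : embedding (sval X') (sval (K X)),
    eta X =1 g \o widen _ _ (leqnSn m).
  apply: (eta_ext X X'); exists top; apply/generates_bare.
  apply/seteqP; split=> // -[i im1] _; have [im|im] := ltnP i m.
    by left; exists (exist _ i im) => //; exact: small_ord_inj.
  by right; apply: small_ord_inj; apply/eqP; rewrite eqn_leq im -ltnS im1.
pose z := g top.
(* [eta X] factors as [g] after the inclusion of [X] in [X'], which misses [top], and [g] is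
   injective. *)
have zN j : eta X j <> z.
  rewrite gE /= => /emb_inj /(congr1 sval) /= jm.
  by move: (svalP j); rewrite /= jm ltnn.
have [i iE] := embedding_ord_onto (eta Y) (svalP (K Y)) (fmap K f z).
(* Naturality turns [eta Y (swap i)] into [fmap K swap (fmap K f z)], which is [fmap K f z], that is
   [eta Y i], by functoriality and [swapf]. *)
have swapi : swap i = i.
  apply: (@emb_inj _ _ _ (eta Y)); have /= -> := eta_nat Y Y swap i.
  by rewrite iE -[RHS](congr1 (fun h => fmap K h z) swapf) fmap_comp.
(* If [i] were below [m], it would be [f j], and naturality along [f] would give [eta X j = z].
   Hence [i] is [a] or [b], which [swap] does move. *)
have [im|mi] := ltnP (sval i) m.
  pose j : small_ord m := exist _ (sval i) im.
  case: (zN j); apply: (@emb_inj _ _ _ (fmap K f)).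
  have /= <- := eta_nat X Y f j.
  by rewrite -iE; congr (eta Y _); exact: small_ord_inj.
have [ia|ib] : i = a \/ i = b.
  move: mi; rewrite leq_eqVlt => /orP[/eqP mi|mi]; [left|right].
    exact: small_ord_inj.
  by apply: small_ord_inj; apply/eqP; rewrite eqn_leq mi -ltnS (svalP i).
- by move: swapi; rewrite ia /= tpermL => /(congr1 sval) /esym /= /n_Sn.
- by move: swapi; rewrite ib /= tpermR => /(congr1 sval) /= /n_Sn.
Qed.

Theorem corollary1p3 (n : nat) (hn : 3 <= n) :
  fraisse_class (sets_card_le n) /\
  ~ (exists K : emb_functor (sets_card_le n) (sigma_class (sets_card_le n)),
       is_katetov K).
Proof.
split; first exact: sets_card_le_fraisse.
case: n hn => [|[|m]] // _ [K].
exact: no_katetov_functor.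
Qed.
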